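(* Let $m\geq 2$ be an integer and let $p$ be an odd prime. Let $(G,\{\rho_0,\rho_1,\rho_2\})$ be a non-degenerate string C-group of rank three and order $4p^m$ with Schläfli type $\{k_1,k_2\}$. Let $P$ be a Sylow $p$-subgroup of $G$. Then: (1) $G\cong P\rtimes\langle\rho_0,\rho_2\rangle$; (2) up to duality, $p\mid k_1$ and $2p\mid k_2$ (that is, either $p\mid k_1$ and $2p\mid k_2$, or $p\mid k_2$ and $2p\mid k_1$); (3) $d(P)=2$.
   Context: A string C-group of rank three is a pair $(G,\{\rho_0,\rho_1,\rho_2\})$ where $G$ is a group and $(\rho_0,\rho_1,\rho_2)$ is an ordered triple of distinct involutions of $G$ such that: $G=\langle\rho_0,\rho_1,\rho_2\rangle$; $\rho_0\rho_2=\rho_2\rho_0$ (string property); and for all $I,J\subseteq\{0,1,2\}$, $\langle\rho_i\mid i\in I\rangle\cap\langle\rho_j\mid j\in J\rangle=\langle\rho_k\mid k\in I\cap J\rangle$ (intersection property). Its order is $|G|$. Its Schläfli type is the ordered pair $\{k_1,k_2\}$ with $k_1=o(\rho_0\rho_1)$ and $k_2=o(\rho_1\rho_2)$, where $o(g)$ is the order of $g$. It is non-degenerate if $k_1\neq 2$ and $k_2\neq 2$ (so $k_1,k_2\geq 3$). The dual of $(G,\{\rho_0,\rho_1,\rho_2\})$ is the string C-group $(G,\{\rho_2,\rho_1,\rho_0\})$ obtained by reversing the order of the generators; its type is $\{k_2,k_1\}$. For a group $H$, $d(H)$ denotes the size of a smallest generating set of $H$. In (1), $P\rtimes\langle\rho_0,\rho_2\rangle$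 is the internal semidirect product: $P\trianglelefteq G$, $P\cap\langle\rho_0,\rho_2\rangle=1$ and $G=P\langle\rho_0,\rho_2\rangle$. *)

(* Defs.v *)
From HB Require Import structures.
From mathcomp Require Import all_boot all_fingroup all_solvable.

Set Implicit Arguments.
Unset Strict Implicit.
Unset Printing Implicit Defensive.

Local Open Scope group_scope.

Definition std_subgroup (gT : finGroupType) (rho0 rho1 rho2 : gT)
    (I : {set 'I_3}) : {set gT} :=
  <<[set tnth [tuple rho0; rho1; rho2] i | i in I]>>.

Record string_C_group (gT : finGroupType) (G : {group gT})
    (rho0 rho1 rho2 : gT) : Prop := StringCGroup {
  scg_distinct : uniq [:: rho0; rho1; rho2];
  scg_involutions : [/\ #[rho0] = 2, #[rho1] = 2 & #[rho2] = 2];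
  scg_generated : <<[set rho0; rho1; rho2]>> = G;
  scg_string : rho0 * rho2 = rho2 * rho0;
  scg_intersection : forall I J : {set 'I_3},
    std_subgroup rho0 rho1 rho2 I :&: std_subgroup rho0 rho1 rho2 J =
      std_subgroup rho0 rho1 rho2 (I :&: J)
}.

Definition schlafli_type (gT : finGroupType) (rho0 rho1 rho2 : gT) :
    nat * nat :=
  (#[rho0 * rho1], #[rho1 * rho2]).

Definition nondegenerate (gT : finGroupType) (rho0 rho1 rho2 : gT) : Prop :=
  (schlafli_type rho0 rho1 rho2).1 <> 2 /\
  (schlafli_type rho0 rho1 rho2).2 <> 2.

(* Main.v *)
Require Import Defs.
From HB Require Import structures.
From mathcomp Require Import all_boot all_fingroup all_solvable.

Set Implicit Arguments.
Unset Strict Implicit.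
Unset Printing Implicit Defensive.

Local Open Scope group_scope.

(** Let H = <rho0, rho2>. Two distinct commuting involutions generate a Klein
    four-group, so H is a complement to P in the sense of sets: P * H = G and
    P :&: H = 1.

    P is normal because an involution of G has few ways to act on the four
    cosets of P. No conjugate of an involution lies in the odd group P, so
    rho1 acts on these cosets without fixed points. There are only three
    fixed-point-free involutions on four points, and the three involutions of
    the regular group H account for all of them. Hence rho1 acts like some h
    in H, and u = rho1 * h lies in the normal core of P
    ([involution_mod_gcore]). The product of this core with H is a subgroup
    that contains all the generators, so by counting the core is P
    ([invariant_complement_eq]).

    The same counting argument bounds the number of generators of P. As rho1 is
    an involution, h inverts u. For k in H outside <h>, the subgroup
    <u, u ^ k> is therefore normalised by h and k, that is, by H, and its
    product with H contains rho1; hence it is all of P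
    ([normal_complement_klein4]). On the other hand P is not cyclic:
    (rho0 * rho1) ^+ 2 and (rho1 * rho2) ^+ 2 are in P, since G / P has
    exponent 2, and they are nontrivial by non-degeneracy. In a cyclic p-group
    they would have a common nontrivial power, but by the intersection property
    such a power lies in <rho1>, which meets P trivially.

    The divisibility statement comes from the same two squares. Being
    nontrivial elements of a p-group, they make p divide both orders. The
    product of rho0 * rho1 and rho1 * rho2 is rho0 * rho2, outside P, so one of
    the two factors is outside P, and an element outside P with square in P has
    even order. *)

(** * Klein four-groups *)

Lemma abelem2_mulgg (gT : finGroupType) (H : {group gT}) (y : gT) :
  2.-abelem H -> y \in H -> y * y = 1.
Proof. by case/abelemP=> // _ sqH /sqH. Qed.

Lemma abelem2_invg (gT : finGroupType) (H : {group gT}) (y : gT) :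
  2.-abelem H -> y \in H -> y^-1 = y.
Proof.
by move=> abH Hy; apply/eqP; rewrite eq_invg_mul (abelem2_mulgg abH Hy).
Qed.

Lemma klein4_gen (gT : finGroupType) (a b : gT) :
    #[a] = 2 -> #[b] = 2 -> a * b = b * a -> a != b ->
  2.-abelem <<[set a; b]>> /\ #|<<[set a; b]>>| = 4.
Proof.
move=> oa ob cab neq_ab.
have nt x : #[x] = 2 -> x != 1 :> gT by move=> ox; rewrite -order_gt1 ox.
have defH : <[a]> \x <[b]> = <<[set a; b]>>.
  have ->: <<[set a; b]>> = <[a]> <*> <[b]>.
    by rewrite /cycle joing_idl joing_idr.
  rewrite dprodEY //.
    by rewrite cycle_subG /= cent_cycle; apply/cent1P.
  apply: prime_TIg; first by rewrite -orderE oa.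
  rewrite cycle_subG; apply/negP.
  case/cyclePmin=> [[|[|i]]]; rewrite ob // => _ def_a.
    by have := nt a oa; rewrite def_a eqxx.
  by rewrite def_a expg1 eqxx in neq_ab.
split; last by rewrite -(dprod_card defH) -!orderE oa ob.
have ab x : #[x] = 2 -> 2.-abelem <[x]>.
  by move=> ox; rewrite prime_abelem // -orderE ox.
by rewrite (dprod_abelem 2 defH) !ab.
Qed.

(** The form in which the order 4 is used: any two distinct nontrivial elements
    of H determine all the others. *)
Lemma klein4E (gT : finGroupType) (H : {group gT}) (h k : gT) :
    2.-abelem H -> #|H| = 4 -> h \in H -> k \in H ->
    h != 1 -> k != 1 -> k != h ->
  H :=: [set 1; h; k; h * k].
Proof.
move=> abH cardH Hh Hk nt_h nt_k neq_kh; apply/esym/eqP.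
rewrite eqEcard cardH !subUset !sub1set group1 Hh Hk groupM //=.
have neq_h_hk : h != h * k by rewrite -{1}[h]mulg1 (inj_eq (mulgI h)) eq_sym.
have neq_k_hk : k != h * k by rewrite -{1}[k]mul1g (inj_eq (mulIg k)) eq_sym.
have neq_1_hk : 1 != h * k.
  by rewrite eq_sym -eq_invg_mul (abelem2_invg abH Hh) eq_sym.
rewrite -!setUA !cardsU1 cards1 !inE (eq_sym 1 h) (eq_sym 1 k) (eq_sym h k).
rewrite (negPf nt_h) (negPf nt_k) (negPf neq_kh).
by rewrite (negPf neq_h_hk) (negPf neq_k_hk) (negPf neq_1_hk).
Qed.

Lemma klein4_third (gT : finGroupType) (H : {group gT}) (h : gT) :
    2.-abelem H -> #|H| = 4 -> h \in H -> exists k,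
  [/\ k \in H, k != 1 & k != h].
Proof.
move=> abH cardH Hh.
have : ~~ (H \subset [set 1; h]).
  apply: contraL (eqxx #|H|) => /subset_leq_card.
  by rewrite cardH cards2; case: (_ != _).
case/subsetPn=> k Hk; rewrite !inE negb_or => /andP[nt_k neq_kh].
by exists k.
Qed.

(** * Normality of an odd complement to a Klein four-group *)

Lemma order2_notin_odd (gT : finGroupType) (P : {group gT}) (t : gT) :
  odd #|P| -> #[t] = 2 -> t \notin P.
Proof.
by move=> oddP ot; apply: contraL oddP => /order_dvdG; rewrite ot dvdn2.
Qed.

Lemma odd_TI_card4 (gT : finGroupType) (P H : {group gT}) :
  odd #|P| -> #|H| = 4 -> P :&: H = 1.
Proof.
move=> oddP cardH; apply: coprime_TIg.
by rewrite cardH (@coprimeXr 2 _ 2) // coprimen2.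
Qed.

(** H represents the cosets of P, and for y and z in H the condition
    y * t * z \in P says that t moves the coset of y to the coset of z (as
    z = z^-1). This relation is the graph of a fixed-point-free involution of
    H. If it sends 1 to h, it must exchange the two other elements k and h * k,
    so it is multiplication by h; then t * h fixes every coset of P. *)
Lemma involution_mod_gcore (gT : finGroupType) (G P H : {group gT}) (t : gT) :
    odd #|P| -> 2.-abelem H -> #|H| = 4 -> P * H = G ->
    t \in G -> #[t] = 2 ->
  exists2 h, h \in H & t * h \in gcore P G.
Proof.
move=> oddP abH cardH defG Gt ot.
have invH := abelem2_invg abH; have sqH := abelem2_mulgg abH.
have tiPH := odd_TI_card4 oddP cardH.
have moves y : y \in H -> exists2 z, z \in H & y * t * z \in P.
  move=> Hy; have: y * t \in P * H.
    by rewrite defG groupM // -defG (subsetP (mulG_subr _ _)).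
  by case/mulsgP=> a b Pa Hb ->; exists b^-1; rewrite ?groupV ?mulgK.
have sym y z : y \in H -> z \in H -> y * t * z \in P -> z * t * y \in P.
  move=> Hy Hz; rewrite -groupV !invMg (invH y) ?(invH z) // mulgA.
  by have -> : t^-1 = t by apply: invg2id.
have inj y y' z : y \in H -> y' \in H ->
    y * t * z \in P -> y' * t * z \in P -> y = y'.
  move=> Hy Hy' Pyz Py'z; apply/eqP; rewrite eq_mulgV1 -in_set1 -[[set 1]]tiPH.
  rewrite inE (groupM Hy) ?groupV // andbT.
  by have := groupM Pyz (groupVr Py'z); rewrite !invMg !mulgA !mulgK.
(* A coset fixed by t would put a conjugate of t in P. *)
have irr y : y \in H -> y * t * y \notin P.
  move=> Hy; rewrite -{1}(invH y Hy) -mulgA -/(t ^ y).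
  by rewrite order2_notin_odd // orderJ.
have [h Hh] := moves 1 (group1 H); rewrite mul1g => Pth.
have nt_h : h != 1.
  by apply: contraTneq Pth => ->; rewrite mulg1 order2_notin_odd.
have Pht : h * t * 1 \in P by rewrite sym // mul1g.
have [k [Hk nt_k neq_kh]] := klein4_third abH cardH Hh.
have Hhk : h * k \in H by rewrite groupM.
(* The image of k is not 1 or h, which are exchanged with each other, and not
   k itself; only h * k is left. *)
have Pk : k * t * (h * k) \in P.
  have [z Hz Pkz] := moves k Hk.
  move: (Hz); rewrite {1}(klein4E abH cardH Hh Hk nt_h nt_k neq_kh) !inE.
  case/orP=> [/orP[/orP[]|]|] /eqP eq_z; move: Pkz; rewrite eq_z // => Pkz.
  - by case/eqP: neq_kh; apply: (inj _ _ 1).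
  - by case/eqP: nt_k; apply: (inj _ _ h); rewrite ?mul1g.
  - by case/negP: (irr k Hk).
exists h => //.
have shift y : y \in H -> y * t * (h * y) \in P.
  rewrite {1}(klein4E abH cardH Hh Hk nt_h nt_k neq_kh) !inE.
  case/orP=> [/orP[/orP[]|]|] /eqP->; rewrite ?mul1g ?mulg1 //.
  - by rewrite sqH // mulg1 -[_ * t]mulg1.
  - by rewrite (mulgA h h) sqH // mul1g sym.
apply/bigcapP=> x; rewrite -defG => /mulsgP[a y Pa Hy ->].
rewrite conjsgM (conjGid Pa) mem_conjg conjgE invgK (invH y Hy).
by have := shift y Hy; rewrite !mulgA.
Qed.

(** Q * H is a subgroup, so it contains all of P * H as soon as it contains
    generators; as Q is contained in P, comparing orders gives equality. *)
Lemma invariant_complement_eq (gT : finGroupType)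
    (Q P H : {group gT}) (S : {set gT}) :
    P :&: H = 1 -> Q \subset P -> H \subset 'N(Q) ->
    P * H = <<S>> -> S \subset Q * H ->
  Q :=: P.
Proof.
move=> tiPH sQP nQH defG sSQH; apply/eqP; rewrite eqEcard sQP /=.
have sPHQH: P * H \subset Q * H.
  by rewrite defG -(norm_joinEr nQH) gen_subG /= norm_joinEr.
have tiQH: Q :&: H = 1 by apply/trivgP; rewrite -tiPH setSI.
have := subset_leq_card sPHQH.
by rewrite (TI_cardMg tiPH) (TI_cardMg tiQH) leq_pmul2r ?cardG_gt0.
Qed.

(** Both claims apply [invariant_complement_eq] to a subgroup of P that contains
    u = t * h, with h from [involution_mod_gcore]: the normal core of P, then
    the subgroup generated by u and one conjugate u ^ k. The latter is
    H-invariant because h inverts u and commutes with k, while k exchanges the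
    two generators. *)
Lemma normal_complement_klein4 (gT : finGroupType) (G P H : {group gT})
    (t : gT) :
    odd #|P| -> 2.-abelem H -> #|H| = 4 -> P * H = G ->
    <<t |: H>> = G -> #[t] = 2 ->
  P ><| H = G /\ exists u v, <<[set u; v]>> = P.
Proof.
move=> oddP abH cardH defG genG ot.
have tiPH := odd_TI_card4 oddP cardH.
have Gt : t \in G by rewrite -genG mem_gen ?setU11.
have sHG : H \subset G by rewrite -defG mulG_subr.
have defPH : P * H = <<t |: H>> by rewrite genG.
have [h Hh Kth] := involution_mod_gcore oddP abH cardH defG Gt ot.
have sqh := abelem2_mulgg abH Hh.
have tE : t = (t * h) * h by rewrite -mulgA sqh mulg1.
have gens (Q : {group gT}) : t * h \in Q -> t |: H \subset Q * H.
  move=> Qth; rewrite subUset mulG_subr sub1set andbT {1}tE.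
  by apply/mulsgP; exists (t * h) h.
have defP : gcore P G = P.
  apply: (invariant_complement_eq tiPH (gcore_sub P G) _ defPH (gens _ Kth)).
  exact: subset_trans sHG (gcore_norm P G).
have nPG : G \subset 'N(P) by rewrite -defP gcore_norm.
split; first by rewrite sdprodE // (subset_trans sHG).
set u := t * h in Kth tE.
have Pu : u \in P by rewrite -defP.
have nt_h : h != 1.
  by apply: contraTneq Pu => h1; rewrite /u h1 mulg1 order2_notin_odd.
have [k [Hk nt_k neq_kh]] := klein4_third abH cardH Hh.
exists u, (u ^ k); set Q := <<_>>.
have Qu : u \in Q by rewrite mem_gen // !inE eqxx.
have Quk : u ^ k \in Q by rewrite mem_gen // !inE eqxx orbT.
(* t = u * h is an involution, and so is h. *)
have uh : u ^ h = u^-1.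
  rewrite conjgE (abelem2_invg abH Hh) /u invMg (abelem2_invg abH Hh) -!mulgA.
  by rewrite sqh mulg1; congr (_ * _); apply/esym/invg2id.
have chk : commute h k by apply: (centsP (abelem_abelian abH)).
have nQ x : u ^ x \in Q -> (u ^ k) ^ x \in Q -> x \in 'N(Q).
  by move=> Qux Qukx; rewrite inE -genJ gen_subG conjUg !conjg_set1 subUset
    !sub1set Qux.
have nQh : h \in 'N(Q).
  by apply: nQ; rewrite ?uh ?groupV // -conjgM -chk conjgM uh conjVg groupV.
have nQk : k \in 'N(Q).
  by apply: nQ; rewrite // -conjgM (abelem2_mulgg abH Hk) conjg1.
apply: (@invariant_complement_eq _ _ _ H _ tiPH _ _ defPH (gens _ Qu)).
  rewrite gen_subG subUset !sub1set Pu memJ_norm //.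
  by rewrite (subsetP nPG) ?(subsetP sHG).
rewrite (klein4E abH cardH Hh Hk nt_h nt_k neq_kh) !subUset !sub1set.
by rewrite group1 nQh nQk groupM.
Qed.

(** * Elements whose square lies in a p-subgroup *)

Lemma sdprod_sqr (gT : finGroupType) (G P H : {group gT}) (g : gT) :
  P ><| H = G -> 2.-abelem H -> g \in G -> g ^+ 2 \in P.
Proof.
case/sdprodP=> _ defG nPH _ abH; rewrite -defG => /mulsgP[a y Pa Hy ->].
have -> : (a * y) ^+ 2 = a * a ^ y.
  by rewrite conjgE (abelem2_invg abH Hy) expgS expg1 !mulgA.
by rewrite groupM // memJ_norm // (subsetP nPH).
Qed.

Lemma dvdn_order_sqr (gT : finGroupType) (p : nat) (P : {group gT}) (g : gT) :
  p.-group P -> g ^+ 2 \in P -> g ^+ 2 != 1 -> p %| #[g].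
Proof.
move=> pP Pg2 nt_g2; apply: dvdn_trans (orderXdvd g 2).
have: p.-group <[g ^+ 2]> by apply: pgroupS pP; rewrite cycle_subG.
by case/pgroup_pdiv; rewrite ?cycle_eq1.
Qed.

(** An element of odd order is a power of its square. *)
Lemma dvdn2_order_sqr (gT : finGroupType) (P : {group gT}) (g : gT) :
  g ^+ 2 \in P -> g \notin P -> 2 %| #[g].
Proof.
move=> Pg2; apply: contraR => oddg; rewrite -cycle_subG.
have /eqP->: generator <[g]> (g ^+ 2).
  by rewrite generator_coprime coprimen2 -[odd _]negbK -dvdn2.
by rewrite cycle_subG.
Qed.

(** * Cyclic p-groups and numbers of generators *)

(** Otherwise A and B would form a nontrivial direct decomposition of a cyclic
    p-group. *)
Lemma cyclic_pgroup_meet (gT : finGroupType) (p : nat) (P A B : {group gT}) :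
    cyclic P -> p.-group P -> A \subset P -> B \subset P ->
    A != 1 :> {set gT} -> B != 1 :> {set gT} ->
  A :&: B != 1.
Proof.
move=> cycP pP sAP sBP ntA ntB; apply/eqP=> tiAB.
have cAB : B \subset 'C(A).
  by apply: subset_trans sBP (subset_trans (cyclic_abelian cycP) (centS sAP)).
have sABP : A <*> B \subset P by rewrite join_subG sAP.
have := cyclic_pgroup_dprod_trivg (pgroupS sABP pP) (cyclicS sABP cycP)
  (dprodEY cAB tiAB).
by case=> [][/eqP]; rewrite ?(negPf ntA) ?(negPf ntB).
Qed.

Lemma grank_eq2 (gT : finGroupType) (P : {group gT}) (u v : gT) :
  ~~ cyclic P -> <<[set u; v]>> = P -> 'm(P) = 2.
Proof.
move=> ncycP defP; apply/eqP; rewrite eqn_leq; apply/andP; split.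
  by rewrite -defP (leq_trans (grank_min _)) // cards2; case: (_ != _).
rewrite ltnNge; apply: contra ncycP; have [B defB <-] := grank_witness P.
move=> leB1; apply/cyclicP; have [B0|[x Bx]] := set_0Vmem B.
  by exists 1; rewrite -defB B0 gen0 cycle1.
exists x; rewrite -defB /cycle; congr <<_>>.
by apply/esym/eqP; rewrite eqEcard sub1set Bx cards1.
Qed.

(** * String C-groups of order 4p^m *)

Lemma string_C_group_meet01_12 (gT : finGroupType) (G : {group gT})
    (rho0 rho1 rho2 : gT) :
    string_C_group G rho0 rho1 rho2 ->
  <<[set rho0; rho1]>> :&: <<[set rho1; rho2]>> = <[rho1]>.
Proof.
case=> _ _ _ _ /(_ [set ord0; inord 1] [set inord 1; ord_max]).
have -> : [set ord0; inord 1] :&: [set inord 1; ord_max] = [set inord 1 : 'I_3].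
  by apply/setP=> -[[|[|[|]]] ?] //; rewrite !inE -!val_eqE /= inordK.
by rewrite /std_subgroup !imsetU1 !imset_set1 !(tnth_nth 1) /= inordK.
Qed.

Theorem theorem1p1 (m p : nat) (m_ge2 : (2 <= m)%N)
    (p_prime : prime p) (p_odd : odd p)
    (gT : finGroupType) (G : {group gT}) (rho0 rho1 rho2 : gT) (k1 k2 : nat)
    (scgG : string_C_group G rho0 rho1 rho2)
    (nondegG : nondegenerate rho0 rho1 rho2)
    (cardG : #|G| = (4 * p ^ m)%N)
    (typeG : schlafli_type rho0 rho1 rho2 = (k1, k2))
    (P : {group gT}) (sylP : p.-Sylow(G) P) :
  [/\ P ><| <<[set rho0; rho2]>> = G,
      ((p %| k1) && (2 * p %| k2)) || ((p %| k2) && (2 * p %| k1))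
    & 'm(P) = 2].
Proof.
case: (scgG) => uniq_rho [o0 o1 o2] genG c02 _.
case: nondegG; case: typeG => <- <- /= nd1 nd2.
move: uniq_rho; rewrite /= !inE negb_or => /and3P[/andP[n01 n02] n12 _].
have [abH cardH] := klein4_gen o0 o2 c02 n02.
set H := <<_>> in abH cardH *.
have pP := pHall_pgroup sylP; have sPG := pHall_sub sylP.
have cardP : #|P| = (p ^ m)%N.
  have co4 : coprime p 4 by rewrite (@coprimeXr 2 _ 2) // coprimen2.
  have pm_gt0 : 0 < p ^ m by rewrite expn_gt0 prime_gt0.
  by rewrite (card_Hall sylP) cardG p_part lognM // pfactorK // logn_coprime.
have oddP : odd #|P| by rewrite cardP oddX p_odd orbT.
have G0 : rho0 \in G by rewrite -genG mem_gen // !inE eqxx.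
have G1 : rho1 \in G by rewrite -genG mem_gen // !inE eqxx orbT.
have G2 : rho2 \in G by rewrite -genG mem_gen // !inE eqxx orbT.
have sHG : H \subset G by rewrite gen_subG subUset !sub1set G0.
have tiPH := odd_TI_card4 oddP cardH.
have defG : P * H = G.
  apply/eqP; rewrite eqEcard mul_subG // (TI_cardMg tiPH) cardG cardH cardP.
  by rewrite mulnC leqnn.
have genG1 : <<rho1 |: H>> = G.
  rewrite -[LHS]/([set rho1] <*> <<_>>) joing_idr -genG; congr <<_>>.
  by rewrite setUCA setUA.
have [sdG [u [v genP]]] :=
  normal_complement_klein4 oddP abH cardH defG genG1 o1.
have sqP g : g \in G -> g ^+ 2 \in P by apply: sdprod_sqr sdG abH.
have ntsq (x y : gT) : #[x] = 2 -> #[y] = 2 -> x != y -> #[x * y] <> 2 ->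
    (x * y) ^+ 2 != 1.
  move=> ox oy neq_xy nd; apply: contra_notN nd => sq1.
  apply: nt_prime_order => //; first exact/eqP.
  by rewrite -eq_invg_mul (_ : x^-1 = x) //; apply: invg2id.
have nt1 := ntsq _ _ o0 o1 n01 nd1; have nt2 := ntsq _ _ o1 o2 n12 nd2.
have P1 := sqP _ (groupM G0 G1); have P2 := sqP _ (groupM G1 G2).
split=> //.
  have p1 := dvdn_order_sqr pP P1 nt1; have p2 := dvdn_order_sqr pP P2 nt2.
  have cop2p : coprime 2 p by rewrite coprime2n.
  rewrite !Gauss_dvd // p1 p2 !andbT /=.
  (* It remains to find an even order among those of rho0 * rho1 and
     rho1 * rho2; their product rho0 * rho2 is not in P. *)
  have notP02 : rho0 * rho2 \notin P.
    apply/negP=> P02; have : rho0 * rho2 \in P :&: H.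
      by rewrite inE P02 groupM ?mem_gen // !inE eqxx ?orbT.
    rewrite tiPH inE -eq_invg_mul (_ : rho0^-1 = rho0) ?(negPf n02) //.
    exact: invg2id.
  have [P12|/(dvdn2_order_sqr P2)->//] := boolP (rho1 * rho2 \in P).
  apply/orP; right; apply: dvdn2_order_sqr P1 _.
  apply: contra notP02 => P01; have := groupM P01 P12.
  by rewrite -mulgA (mulgA rho1) -{1}(invg2id o1) mulVg mul1g.
apply: grank_eq2 genP; apply/negP=> cycP.
have := cyclic_pgroup_meet cycP pP (A := <[(rho0 * rho1) ^+ 2]>)
  (B := <[(rho1 * rho2) ^+ 2]>).
rewrite !cycle_subG !cycle_eq1 => /(_ P1 P2 nt1 nt2)/eqP; apply; apply/trivgP.
rewrite -(prime_TIg (G := <[rho1]>) (H := P)) -?orderE ?o1 ?cycle_subG //;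
  last exact: order2_notin_odd.
rewrite subsetI andbC subIset /=; last by rewrite cycle_subG P1.
rewrite -(string_C_group_meet01_12 scgG).
by rewrite setISS // cycle_subG groupX // groupM // mem_gen // !inE eqxx ?orbT.
Qed.
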